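(* Let $M$ be a lightlike hypersurface of an indefinite statistical manifold $(\overline{M},\overline{g},\overline{\nabla},\overline{\nabla}^{*})$, with screen distribution $S(TM)$, radical distribution $\mathrm{Rad}(TM)$ spanned by $\xi$, and induced connections $\nabla$ and $\nabla^{*}$. Let $P$ be the projection of $TM$ onto $S(TM)$ along $\mathrm{Rad}(TM)$. The following assertions are equivalent: (1) $\mathrm{Rad}(TM)$ and $S(TM)$ are parallel with respect to both $\nabla$ and $\nabla^{*}$; (2) the screen projection $P$ is parallel with respect to both $\nabla$ and $\nabla^{*}$, i.e. $\nabla P=0$ and $\nabla^{*}P=0$; (3) $A_{\xi}=A_{\xi}^{*}=0$ and $C=C^{*}=0$ on $TM\times S(TM)$; (4) $P$ is parallel with respect to $\nabla^{0}$, i.e. $\nabla^0P=0$, and $K(X,PY)=P K(X,Y)$ for all $X,Y\in\Gamma(TM)$.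
   Context: $\Gamma(E)$ denotes smooth sections of $E$. An indefinite statistical manifold $(\overline{M},\overline{g},\overline{\nabla},\overline{\nabla}^{*})$ is a semi-Riemannian manifold $(\overline M,\overline g)$ with a torsion-free affine connection $\overline\nabla$ satisfying the Codazzi condition $(\overline{\nabla}_{X}\overline{g})(Y,Z)=(\overline{\nabla}_{Y}\overline{g})(X,Z)$, together with the dual connection $\overline\nabla^{*}$ determined by $X\overline{g}(Y,Z)=\overline{g}(\overline{\nabla}_{X}Y,Z)+\overline{g}(Y,\overline{\nabla}^{*}_{X}Z)$ (which is then also torsion-free). $M$ is a lightlike hypersurface: $M$ has codimension one and the induced metric $g$ is degenerate, so $\mathrm{Rad}(TM)=TM\cap TM^{\perp}=TM^{\perp}$ is a rank-one bundle. A screen distribution $S(TM)$ is a non-degenerate distribution complementary to $\mathrm{Rad}(TM)$ in $TM$; one is fixed. Fix a nowhere-zero section $\xi$ of $\mathrm{Rad}(TM)$ (in general it exists only locally, and all objects depending on it are understood on its domain). $N$ is the unique vector field along $M$ with $\overline{g}(N,N)=0$, $\overline{g}(N,\xi)=1$, $\overline{g}(N,W)=0$ for all $W\in\Gamma(S(TM))$; then $T\overline M|_M=TM\oplus\mathrm{span}\{N\}$. For $X,Y\in\Gamma(TM)$ the Gauss formulas $\overline{\nabla}_{X}Y=\nabla_{X}Y+B(X,Y)N$ and $\overline{\nabla}^{*}_{X}Y=\nabla^{*}_{X}Y+B^{*}(X,Y)N$, with $\nabla_XY,\nabla^*_XY\in\Gamma(TM)$, define the induced torsion-free connections $\nabla,\nabla^{*}$.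 The screen-valued operators $A_{\xi},A_{\xi}^{*}:TM\to S(TM)$ and one-forms $\tau,\tau^{*}$ are defined by $\nabla_{X}\xi=-A_{\xi}X-\tau(X)\xi$ and $\nabla^{*}_{X}\xi=-A^{*}_{\xi}X-\tau^{*}(X)\xi$. For $X\in\Gamma(TM)$, $W\in\Gamma(S(TM))$ the decompositions $\nabla_{X}W=\nabla^{S}_{X}W+C(X,W)\xi$ and $\nabla^{*}_{X}W=\nabla^{*S}_{X}W+C^{*}(X,W)\xi$, with $\nabla^{S}_{X}W,\nabla^{*S}_XW\in\Gamma(S(TM))$, define $C,C^{*}$. Put $\nabla^{0}=\frac12(\nabla+\nabla^{*})$ and $K(X,Y)=\frac12(\nabla_XY-\nabla^{*}_XY)$. For a connection $D$ on $M$, $(D_XP)Y=D_X(PY)-P(D_XY)$. A distribution $\mathcal D$ on $M$ is parallel with respect to $D$ if $D_XY\in\Gamma(\mathcal D)$ for all $X\in\Gamma(TM)$, $Y\in\Gamma(\mathcal D)$. *)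

(* Defs.v *)
From HB Require Import structures.
From mathcomp Require Import all_boot all_order all_algebra.
From mathcomp Require Import all_classical all_reals all_analysis.

Set Implicit Arguments.
Unset Strict Implicit.
Unset Printing Implicit Defensive.

Import Order.TTheory GRing.Theory Num.Theory.
Import numFieldNormedType.Exports.

Local Open Scope classical_set_scope.
Local Open Scope ring_scope.

Lemma near_eq_differentiable (K : realFieldType) (V W : normedModType K)
    (f g : V -> W) (x : V) :
  {near x, f =1 g} -> differentiable f x -> differentiable g x.
Proof.
move=> fg df; have -> : g = f + (g - f) by rewrite addrC subrK.
apply: differentiableD => //; apply/diff_locallyP.
set h := g - f.
have h0 : h x = 0 by rewrite /h !fctE (nbhs_singleton fg) subrr.
have hE : h \o shift x = cst (h x) + (\0 : {linear V -> W}) +o_ 0 id.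
  apply/eqaddoP => _/posnumP[e]; rewrite h0.
  have /nbhs0P fg0 := fg; near=> y.
  have fgy : f (y + x) = g (y + x) by rewrite addrC; near: y.
  by rewrite /h /= !fctE /= fgy subrr addr0 subrr normr0 mulr_ge0.
have c0 : continuous (\0 : {linear V -> W}) by move=> y; exact: cst_continuous.
by rewrite (diff_unique c0 hE); split.
Unshelve. all: by end_near. Qed.

Section SmoothFunctions.
Context {R : realType} {n : nat}.
Implicit Types (U : set 'rV[R]_n) (f g : 'rV[R]_n -> R).

Fixpoint times_differentiable (k : nat) U f : Prop :=
  if k is k'.+1 then
    (forall x, U x -> differentiable f x) /\
    (forall i, times_differentiable k' U (fun x => 'D_(delta_mx 0 i) f x))
  else True.

(* Only used for open [U]; the derivatives are Frechet derivatives, so this is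
   the usual notion of a C^infinity function. *)
Definition smooth_on U f := forall k, times_differentiable k U f.

Lemma times_differentiable_ext k U f g : open U ->
  (forall x, U x -> f x = g x) ->
  times_differentiable k U f -> times_differentiable k U g.
Proof.
move=> oU; elim: k f g => [//|k IH] f g fg [df Df] /=.
have nfg x : U x -> \near x, f x = g x.
  by move=> Ux; apply: filterS fg _; exact: open_nbhs_nbhs.
split=> [x Ux|i]; first exact: near_eq_differentiable (nfg x Ux) (df x Ux).
apply: IH (Df i) => x Ux; exact: near_eq_derive (nfg x Ux).
Qed.

Lemma times_differentiableW k U f :
  times_differentiable k.+1 U f -> times_differentiable k U f.
Proof. by elim: k f => [//|k IH] f [df Df]; split => // i; exact: IH (Df i). Qed.

Lemma smooth_on_cst U (a : R) : smooth_on U (cst a).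
Proof.
move=> k; elim: k a => [//|k IH] a; split=> [x _|i]; first exact: differentiable_cst.
have -> : (fun x => 'D_(delta_mx 0 i) (cst a) x) = cst 0 :> ('rV[R]_n -> R).
  by apply/funext => x; rewrite derive_cst.
exact: IH.
Qed.

Lemma times_differentiableD k U f g : open U ->
  times_differentiable k U f -> times_differentiable k U g ->
  times_differentiable k U (f + g).
Proof.
move=> oU; elim: k f g => [//|k IH] f g [df Df] [dg Dg]; split=> [x Ux|i].
  by apply: differentiableD; [exact: df|exact: dg].
apply: times_differentiable_ext oU _ (IH _ _ (Df i) (Dg i)) => x Ux.
by rewrite deriveD //; apply: diff_derivable; [exact: df|exact: dg].
Qed.

Lemma times_differentiableM k U f g : open U ->
  times_differentiable k U f -> times_differentiable k U g ->
  times_differentiable k U (f * g).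
Proof.
move=> oU; elim: k f g => [//|k IH] f g tf tg.
have [[df Df] [dg Dg]] := (tf, tg); split=> [x Ux|i].
  by apply: differentiableM; [exact: df|exact: dg].
have := times_differentiableD oU (IH _ _ (times_differentiableW tf) (Dg i))
                                 (IH _ _ (times_differentiableW tg) (Df i)).
apply: times_differentiable_ext oU _ => x Ux.
by rewrite deriveM //; apply: diff_derivable; [exact: df|exact: dg].
Qed.

End SmoothFunctions.

(* [chart_map] is a homeomorphism from the open set [chart_dom] onto an open
   subset of R^n; outside these two sets both functions are arbitrary. *)
Record chart (R : realType) (n : nat) (T : topologicalType) := Chart {
  chart_dom : set T ;
  chart_map : T -> 'rV[R]_n ;
  chart_inv : 'rV[R]_n -> T ;
  chart_dom_open : open chart_dom ;
  chart_img_open : open (chart_map @` chart_dom) ;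
  chart_mapK : forall p, chart_dom p -> chart_inv (chart_map p) = p ;
  chart_map_continuous : forall p, chart_dom p -> {for p, continuous chart_map} ;
  chart_inv_continuous : forall x, (chart_map @` chart_dom) x ->
    {for x, continuous chart_inv} }.
Arguments chart_dom_open {R n T}.
Arguments chart_img_open {R n T}.

Definition smooth_compatible (R : realType) (n : nat) (T : topologicalType)
    (c d : chart R n T) :=
  forall j : 'I_n, smooth_on (chart_map c @` (chart_dom c `&` chart_dom d))
    (fun x => chart_map d (chart_inv c x) 0 j).

(* The atlas is not required to be maximal. *)
Record manifold (R : realType) (n : nat) := Manifold {
  manifold_sort :> topologicalType ;
  atlas : set (chart R n manifold_sort) ;
  manifold_hausdorff : hausdorff_space manifold_sort ;
  manifold_second_countable : @second_countable manifold_sort ;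
  atlas_cover : forall p, exists2 c, atlas c & chart_dom c p ;
  atlas_compatible : forall c d, atlas c -> atlas d -> smooth_compatible c d }.

Section SmoothFunctionRing.
Context {R : realType} {n : nat} (M : manifold R n).
Implicit Types f g : M -> R.

Definition smooth f := forall c : chart R n M, atlas c ->
  smooth_on (chart_map c @` chart_dom c) (f \o chart_inv c).

Lemma smooth_cst (a : R) : smooth (cst a).
Proof. by move=> c _; exact: smooth_on_cst. Qed.

Lemma smoothD f g : smooth f -> smooth g -> smooth (f + g).
Proof.
move=> sf sg c cM k.
exact: (times_differentiableD (chart_img_open c) (sf c cM k) (sg c cM k)).
Qed.

Lemma smoothM f g : smooth f -> smooth g -> smooth (f * g).
Proof.
move=> sf sg c cM k.
exact: (times_differentiableM (chart_img_open c) (sf c cM k) (sg c cM k)).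
Qed.

Lemma smoothZ (a : R) f : smooth f -> smooth (a *: f).
Proof. by move=> sf; exact: (smoothM (smooth_cst a) sf). Qed.

Lemma smoothN f : smooth f -> smooth (- f).
Proof. by move=> sf; rewrite -scaleN1r; exact: smoothZ. Qed.

Definition Cinf_pred : {pred M -> R} := [pred f | `[< smooth f >]].

Record Cinf := MkCinf { Cinf_fun :> M -> R ; Cinf_subproof : Cinf_fun \in Cinf_pred }.

HB.instance Definition _ := [isSub for Cinf_fun].
HB.instance Definition _ := [Choice of Cinf by <:].

Lemma Cinf_subring_closed : subring_closed Cinf_pred.
Proof.
split=> [|f g|f g]; rewrite !inE /=.
- exact: (smooth_cst 1).
- by move=> sf sg; apply: smoothD => //; exact: smoothN.
- exact: smoothM.
Qed.
HB.instance Definition _ := GRing.isSubringClosed.Build _ Cinf_pred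
  Cinf_subring_closed.
HB.instance Definition _ := GRing.SubChoice_isSubComPzRing.Build _ _ Cinf
  (subringClosedP _).

Lemma Cinf_scaler_closed : scaler_closed Cinf_pred.
Proof. by move=> a f; rewrite !inE; exact: smoothZ. Qed.
HB.instance Definition _ := GRing.isScaleClosed.Build _ _ Cinf_pred
  Cinf_scaler_closed.
HB.instance Definition _ := [SubZmodule_isSubLmodule of Cinf by <:].

Definition mkCinf f (sf : smooth f) : Cinf := MkCinf (asboolT sf).

Lemma Cinf_smooth (f : Cinf) : smooth f.
Proof. by case: f => f /= /asboolP. Qed.

(* Tangent vectors are the derivations at [p] of the algebra of smooth
   functions. *)
Definition tangent (p : M) : set (Cinf -> R) :=
  [set v | (forall (a : R) (f g : Cinf), v (a *: f + g) = a * v f + v g) /\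
           (forall f g : Cinf, v (f * g) = f p * v g + g p * v f)].

End SmoothFunctionRing.
Arguments atlas {R n}.

Section Sections.
Context {R : realType} {m n : nat} {M : manifold R m} {N : manifold R n}.
Variable phi : M -> N.

Definition vsection_pred : {pred M -> Cinf N -> R} :=
  [pred V | `[< (forall p, tangent (phi p) (V p)) /\
                (forall f : Cinf N, smooth (fun p => V p f)) >]].

(* Smooth sections of the pull-back bundle phi^* TN, that is, smooth vector
   fields along phi. *)
Record vsection := MkVsection {
  vsection_fun :> M -> Cinf N -> R ;
  vsection_subproof : vsection_fun \in vsection_pred }.

HB.instance Definition _ := [isSub for vsection_fun].
HB.instance Definition _ := [Choice of vsection by <:].

Definition mkVsection V (tV : forall p, tangent (phi p) (V p))
    (sV : forall f : Cinf N, smooth (fun p => V p f)) : vsection :=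
  MkVsection (asboolT (conj tV sV)).

Lemma vsection_tangent (V : vsection) p : tangent (phi p) (V p).
Proof. by case: V => V /= /asboolP []. Qed.

Lemma vsection_smooth (V : vsection) (f : Cinf N) : smooth (fun p => V p f).
Proof. by case: V => V /= /asboolP []. Qed.

Lemma tangentD (q : N) u v : tangent q u -> tangent q v -> tangent q (u + v).
Proof.
move=> [uL uM] [vL vM]; split=> [a f g|f g]; rewrite !fctE.
  by rewrite uL vL mulrDr addrACA.
by rewrite uM vM !mulrDr addrACA.
Qed.

Lemma tangentZ (q : N) (a : R) v : tangent q v -> tangent q (a *: v).
Proof.
move=> [vL vM]; split=> [b f g|f g]; rewrite !fctE.
  by rewrite vL scalerDr /GRing.scale /= mulrCA.
by rewrite vM scalerDr /GRing.scale /= !(mulrCA a).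
Qed.

Lemma tangent0 (q : N) : tangent q 0.
Proof.
split=> [a f g|f g].
  by change (0 = a * 0 + 0 :> R); rewrite mulr0 addr0.
by change (0 = f q * 0 + g q * 0 :> R); rewrite !mulr0 addr0.
Qed.

Lemma vsection_zmod_closed : zmod_closed vsection_pred.
Proof.
split=> [|V W]; rewrite !inE /=.
  by split=> [p|f]; [exact: tangent0|exact: smooth_cst].
move=> [tV sV] [tW sW]; split=> [p|f].
  have -> : (V - W) p = V p + (-1) *: W p by rewrite scaleN1r.
  by apply: tangentD => //; exact: tangentZ.
exact: (smoothD (sV f) (smoothN (sW f))).
Qed.
HB.instance Definition _ := GRing.isZmodClosed.Build _ vsection_pred
  vsection_zmod_closed.
HB.instance Definition _ := [SubChoice_isSubZmodule of vsection by <:].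

Definition vsection_scale (f : Cinf M) (V : vsection) : vsection :=
  mkVsection (fun p => tangentZ (f p) (vsection_tangent V p))
             (fun g => smoothM (Cinf_smooth f) (vsection_smooth V g)).

Let vsectionP (V W : vsection) : (forall p g, V p g = W p g) -> V = W.
Proof. by move=> VW; apply/val_inj/funext => p; apply/funext => g; exact: VW. Qed.

Let scaleA f g V : vsection_scale f (vsection_scale g V) = vsection_scale (f * g) V.
Proof. by apply: vsectionP => p h; exact: mulrA. Qed.
Let scale1 : left_id 1 vsection_scale.
Proof. by move=> V; apply: vsectionP => p h; exact: mul1r. Qed.
Let scaleDr : right_distributive vsection_scale +%R.
Proof. by move=> f V W; apply: vsectionP => p h; exact: mulrDr. Qed.
Let scaleDl V : {morph vsection_scale^~ V : f g / f + g}.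
Proof. by move=> f g; apply: vsectionP => p h; exact: mulrDl. Qed.

HB.instance Definition _ := GRing.Zmodule_isLmodule.Build (Cinf M) vsection
  scaleA scale1 scaleDr scaleDl.

(* The derivative [V f] of a smooth function along a vector field. *)
Definition vderiv (V : vsection) (f : Cinf N) : Cinf M :=
  mkCinf (vsection_smooth V f).

End Sections.

Notation vfield M := (@vsection _ _ _ M M id).

(* Because of bump functions, testing against global smooth functions amounts
   to smoothness in charts. *)
Record smooth_map (R : realType) (m n : nat) (M : manifold R m)
    (N : manifold R n) := SmoothMap {
  smooth_map_fun :> M -> N ;
  smooth_map_continuous : continuous smooth_map_fun ;
  smooth_map_comp : forall f : N -> R, smooth f -> smooth (f \o smooth_map_fun) }.

Section SmoothMaps.
Context {R : realType} {m n : nat} {M : manifold R m} {N : manifold R n}.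
Variable F : smooth_map M N.

Definition pullback_fun (f : Cinf N) : Cinf M :=
  mkCinf (smooth_map_comp F (Cinf_smooth f)).

(* The differential of [F], on tangent vectors at any point. *)
Definition dmap (v : Cinf M -> R) : Cinf N -> R := fun f => v (pullback_fun f).

Lemma tangent_dmap p v : tangent p v -> tangent (F p) (dmap v).
Proof.
move=> [vL vM]; split=> [a f g|f g].
  by rewrite /dmap -vL; congr v; exact/val_inj.
have -> : dmap v (f * g) = v (pullback_fun f * pullback_fun g).
  by congr v; exact/val_inj.
exact: vM.
Qed.

Definition pushforward (X : vfield M) : vsection F :=
  mkVsection (fun p => tangent_dmap (vsection_tangent X p))
             (fun f => vsection_smooth X (pullback_fun f)).

Definition restrict_along (Z : vfield N) : vsection F :=
  mkVsection (fun p => vsection_tangent Z (F p))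
             (fun f => smooth_map_comp F (vsection_smooth Z f)).

Definition immersion := forall p u v, tangent p u -> tangent p v ->
  dmap u = dmap v -> u = v.

End SmoothMaps.

Section Connections.
Context {R : realType} {m n : nat} {M : manifold R m} {N : manifold R n}.

(* A connection on the pull-back bundle phi^* TN; for phi = id, an affine
   connection. *)
Definition connection (phi : M -> N)
    (D : vfield M -> vsection phi -> vsection phi) :=
  [/\ forall (f : Cinf M) X X' V, D (f *: X + X') V = f *: D X V + D X' V,
      forall X V V', D X (V + V') = D X V + D X V' &
      forall (f : Cinf M) X V, D X (f *: V) = vderiv X f *: V + f *: D X V].

Definition torsion_free (D : vfield M -> vfield M -> vfield M) :=
  forall (X Y : vfield M) (f : Cinf M),
    vderiv (D X Y) f - vderiv (D Y X) f =
    vderiv X (vderiv Y f) - vderiv Y (vderiv X f).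

(* [DF] is determined by [D]: the fields [restrict_along F Z] generate the
   vector fields along [F] locally. [DF X (pushforward F Y)] is the derivative
   of [Y] along [X] with respect to [D], computed with local extensions. *)
Definition pullback_connection (F : smooth_map M N)
    (D : vfield N -> vfield N -> vfield N)
    (DF : vfield M -> vsection F -> vsection F) :=
  connection DF /\
  forall (X : vfield M) (V Z : vfield N) (p : M), V (F p) = dmap F (X p) ->
    DF X (restrict_along F Z) p = D V Z (F p).

End Connections.

Section Metrics.
Context {R : realType} {n : nat} (M : manifold R n).

(* The last condition forces the family [e] to be linearly independent, so [e]
   is a basis of a [k]-dimensional negative definite subspace. *)
Definition has_negative_subspace (g : M -> (Cinf M -> R) -> (Cinf M -> R) -> R)
    (p : M) (k : nat) :=
  exists e : 'I_k -> Cinf M -> R, (forall i, tangent p (e i)) /\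
    forall a : 'I_k -> R, (exists i, a i != 0) ->
      g p (\sum_i a i *: e i) (\sum_i a i *: e i) < 0.

(* A semi-Riemannian metric, of constant index [nu]. The values of
   [metric_form g p] on functionals that are not tangent at [p] are
   irrelevant. *)
Record metric := Metric {
  metric_form :> M -> (Cinf M -> R) -> (Cinf M -> R) -> R ;
  metric_sym : forall p u v, tangent p u -> tangent p v ->
    metric_form p u v = metric_form p v u ;
  metric_linear : forall p (a : R) u v w,
    tangent p u -> tangent p v -> tangent p w ->
    metric_form p (a *: u + v) w = a * metric_form p u w + metric_form p v w ;
  metric_nondegenerate : forall p u, tangent p u ->
    (forall v, tangent p v -> metric_form p u v = 0) -> u = 0 ;
  metric_smooth : forall X Y : vfield M,
    smooth (fun p => metric_form p (X p) (Y p)) ;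
  metric_index : exists nu : nat, forall p k,
    has_negative_subspace metric_form p k <-> (k <= nu)%N }.

Definition metric_fun (g : metric) (X Y : vfield M) : Cinf M :=
  mkCinf (metric_smooth g X Y).

Definition metric_deriv (g : metric) (D : vfield M -> vfield M -> vfield M)
    (X Y Z : vfield M) : Cinf M :=
  vderiv X (metric_fun g Y Z) - metric_fun g (D X Y) Z - metric_fun g Y (D X Z).

Definition codazzi (g : metric) (D : vfield M -> vfield M -> vfield M) :=
  forall X Y Z, metric_deriv g D X Y Z = metric_deriv g D Y X Z.

Definition dual_connection (g : metric) (D D' : vfield M -> vfield M -> vfield M) :=
  forall X Y Z,
    vderiv X (metric_fun g Y Z) = metric_fun g (D X Y) Z + metric_fun g Y (D' X Z).

Definition statistical_manifold (g : metric)
    (D D' : vfield M -> vfield M -> vfield M) :=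
  [/\ connection D, torsion_free D, codazzi g D, connection D' &
      dual_connection g D D'].

End Metrics.

Section Distributions.
Context {R : realType} {n : nat} {M : manifold R n}.

(* A smooth distribution of rank [k]. Local frames are given by global vector
   fields: a local vector field agrees with a global one near a given point. *)
Definition distribution (k : nat) (E : M -> set (Cinf M -> R)) :=
  forall p0 : M, exists e : 'I_k -> vfield M, \forall p \near p0,
    E p = [set v | exists a : 'I_k -> R, v = \sum_i a i *: e i p] /\
    (forall a : 'I_k -> R, \sum_i a i *: e i p = 0 -> forall i, a i = 0).

Definition in_dist (E : M -> set (Cinf M -> R)) (X : vfield M) :=
  forall p, E p (X p).

Definition complementary (E E' : M -> set (Cinf M -> R)) := forall p,
  [/\ E p `<=` tangent p, E' p `<=` tangent p,
      forall v, E p v -> E' p v -> v = 0 &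
      forall v, tangent p v -> exists u w, [/\ E p u, E' p w & v = u + w]].

Definition projection_along (E E' : M -> set (Cinf M -> R))
    (P : vfield M -> vfield M) :=
  forall X, in_dist E (P X) /\ in_dist E' (X - P X).

Definition parallel_dist (D : vfield M -> vfield M -> vfield M)
    (E : M -> set (Cinf M -> R)) :=
  forall X Y, in_dist E Y -> in_dist E (D X Y).

Definition endo_deriv (D : vfield M -> vfield M -> vfield M)
    (P : vfield M -> vfield M) (X Y : vfield M) : vfield M :=
  D X (P Y) - P (D X Y).

Definition parallel_endo (D : vfield M -> vfield M -> vfield M)
    (P : vfield M -> vfield M) :=
  forall X Y, endo_deriv D P X Y = 0.

Definition half : Cinf M := (2^-1 : R) *: (1 : Cinf M).

Definition mean_connection (D D' : vfield M -> vfield M -> vfield M)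
    (X Y : vfield M) : vfield M :=
  half *: (D X Y + D' X Y).

Definition difference_tensor (D D' : vfield M -> vfield M -> vfield M)
    (X Y : vfield M) : vfield M :=
  half *: (D X Y - D' X Y).

End Distributions.

Section LightlikeHypersurfaces.
Context {R : realType} {n : nat} {M : manifold R n} {Mbar : manifold R n.+1}.
Variables (g : metric Mbar) (F : smooth_map M Mbar).

Definition normal_space (p : M) : set (Cinf Mbar -> R) :=
  [set w | tangent (F p) w /\ forall v, tangent p v -> g (F p) w (dmap F v) = 0].

Definition radical (p : M) : set (Cinf M -> R) :=
  [set u | tangent p u /\ normal_space p (dmap F u)].

(* The codimension is one by the dimensions of [M] and [Mbar]; the metric
   induced by [g] is degenerate at every point. *)
Definition lightlike_hypersurface :=
  [/\ injective F, immersion F & forall p, exists2 u, radical p u & u <> 0].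

(* A frame of the radical exists in general only locally; [M] is then the domain
   of the frame, itself a lightlike hypersurface. *)
Definition radical_frame (xi : vfield M) := forall p,
  xi p <> 0 /\ radical p = [set v | exists a : R, v = a *: xi p].

Definition screen_distribution (S : M -> set (Cinf M -> R)) :=
  [/\ distribution n.-1 S, complementary S radical &
      forall p u, S p u ->
        (forall v, S p v -> g (F p) (dmap F u) (dmap F v) = 0) -> u = 0].

Definition lightlike_transversal (S : M -> set (Cinf M -> R)) (xi : vfield M)
    (N : vsection F) := forall p,
  [/\ g (F p) (N p) (N p) = 0,
      g (F p) (N p) (dmap F (xi p)) = 1 &
      forall W : vfield M, in_dist S W -> g (F p) (N p) (dmap F (W p)) = 0].

Definition gauss_formula (N : vsection F)
    (DF : vfield M -> vsection F -> vsection F)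
    (D : vfield M -> vfield M -> vfield M) (B : vfield M -> vfield M -> Cinf M) :=
  forall X Y, DF X (pushforward F Y) = pushforward F (D X Y) + B X Y *: N.

Definition radical_weingarten (S : M -> set (Cinf M -> R)) (xi : vfield M)
    (D : vfield M -> vfield M -> vfield M)
    (A : vfield M -> vfield M) (tau : vfield M -> Cinf M) :=
  forall X, in_dist S (A X) /\ D X xi = - A X - tau X *: xi.

Definition screen_gauss (S : M -> set (Cinf M -> R)) (xi : vfield M)
    (D DS : vfield M -> vfield M -> vfield M) (C : vfield M -> vfield M -> Cinf M) :=
  forall X W, in_dist S W ->
    in_dist S (DS X W) /\ D X W = DS X W + C X W *: xi.

End LightlikeHypersurfaces.

(* Main.v *)
(* Pairing the Gauss formula with [xi] kills the tangential part, so [D]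
   inherits the connection axioms. Since [T M] is the direct sum of the
   screen and the radical, a connection commutes with [P] exactly when it
   preserves both summands; sums and differences of the two commutation
   rules for [nabla] and [nabla^*] give the rule for the mean connection and
   the one for [K]. Finally a section [V] of the radical satisfies [xi(h) V
   = V(h) xi] for every function [h], so by the Leibniz rule it is enough to
   test that the radical is parallel on [xi]. *)
Require Import Defs.
From mathcomp Require Import all_boot all_order all_algebra.
From mathcomp Require Import all_classical all_reals all_analysis.

Set Implicit Arguments.
Unset Strict Implicit.
Unset Printing Implicit Defensive.

Import GRing.Theory.
(* Otherwise [pushforward], [distribution], [half] and [metric_sym] would be
   those of MathComp and MathComp-Analysis. *)
Import Defs.
Local Open Scope classical_set_scope.
Local Open Scope ring_scope.

(** * Sections of linear distributions, and connections on vector fields *)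

Section VectorFields.
Context {R : realType} {n : nat} {M : manifold R n}.
Implicit Types (X Y U V : vfield M) (E S T : M -> set (Cinf M -> R)).

(** Fibres may be empty under this condition; the zero section is therefore derived from a given
    section. *)
Definition linear_dist E := forall p (a : R) u v,
  E p u -> E p v -> E p (a *: u + v).

Lemma vsection_eq {m} {N : manifold R m} (phi : M -> N) (V W : vsection phi) :
  (forall p, V p = W p) -> V = W.
Proof. by move=> VW; apply/val_inj/funext. Qed.

Lemma vsection_at {m} {N : manifold R m} (phi : M -> N) (V W : vsection phi) p :
  V = W -> V p = W p.
Proof. by move=> ->. Qed.

Lemma Cinf_eq (f g : Cinf M) : (forall p, f p = g p) -> f = g.
Proof. by move=> fg; apply/val_inj/funext. Qed.

Lemma distribution_linear k E : distribution k E -> linear_dist E.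
Proof.
move=> dE p a u v; have [e /nbhs_singleton[-> _]] := dE p.
move=> [b ->] [c ->]; exists (fun i => a * b i + c i).
rewrite scaler_sumr -big_split; apply: eq_bigr => i _.
by rewrite scalerDl scalerA.
Qed.

Lemma in_distP E (f : Cinf M) X Y : linear_dist E ->
  in_dist E X -> in_dist E Y -> in_dist E (f *: X + Y).
Proof. by move=> lE EX EY p; exact: lE (EX p) (EY p). Qed.

Lemma in_dist0 E X : linear_dist E -> in_dist E X -> in_dist E 0.
Proof.
move=> lE EX; have -> : 0 = -1 *: X + X by rewrite scaleN1r addNr.
exact: in_distP.
Qed.

Lemma in_distZ E (f : Cinf M) X : linear_dist E ->
  in_dist E X -> in_dist E (f *: X).
Proof.
by move=> lE EX; rewrite -[_ *: _]addr0; apply: in_distP (in_dist0 lE EX).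
Qed.

Lemma in_distB E X Y : linear_dist E ->
  in_dist E X -> in_dist E Y -> in_dist E (X - Y).
Proof. by move=> lE EX EY; rewrite addrC -scaleN1r; exact: in_distP. Qed.

Lemma in_distI0 S T X : complementary S T ->
  in_dist S X -> in_dist T X -> X = 0.
Proof.
by move=> ST SX TX; apply: vsection_eq => p; have [_ _ + _] := ST p; apply.
Qed.

Lemma connection0 {m} {N : manifold R m} (phi : M -> N)
    (D : vfield M -> vsection phi -> vsection phi) X :
  connection D -> D X 0 = 0.
Proof.
by case=> _ + _ => /(_ X 0 0); rewrite addr0 -{1}[D X 0]addr0 => /addrI.
Qed.

Lemma half_double X : half *: (X + X) = X.
Proof.
rewrite scalerDr -scalerDl -[RHS]scale1r; congr (_ *: _).
apply: Cinf_eq => p; change (2^-1 * 1 + 2^-1 * 1 = 1 :> R).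
by rewrite ![_^-1 * 1]mulrC -Num.Theory.splitr.
Qed.

(** * Algebra of the projection attached to a splitting into two distributions *)

Section Projection.
Variables (S T : M -> set (Cinf M -> R)) (P : vfield M -> vfield M).
Hypotheses (linS : linear_dist S) (linT : linear_dist T).
Hypotheses (ST : complementary S T) (hP : projection_along S T P).

(** The difference [U - P (U + V)] lies in [S], and also in [T] because it equals
    [(U + V - P (U + V)) - V]. *)
Lemma projectionE U V : in_dist S U -> in_dist T V -> P (U + V) = U.
Proof.
move=> SU TV; have [SP TP] := hP (U + V).
apply/esym/subr0_eq/(in_distI0 ST); first exact: in_distB.
have -> : U - P (U + V) = U + V - P (U + V) - V by rewrite addrAC addrK.
exact: in_distB.
Qed.

Lemma projectionP (f : Cinf M) X Y : P (f *: X + Y) = f *: P X + P Y.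
Proof.
have [[SX TX] [SY TY]] := (hP X, hP Y).
rewrite -[in LHS](subrK (P X) X) -[in LHS](subrK (P Y) Y).
rewrite ![_ - _ + _]addrC scalerDr addrACA.
by apply: projectionE; exact: in_distP.
Qed.

Lemma projection_id X : in_dist S X -> P X = X.
Proof.
by move=> SX; rewrite -{1}[X]addr0 projectionE //; exact: in_dist0 (hP X).2.
Qed.

Lemma projection_eq0 X : in_dist T X -> P X = 0.
Proof.
by move=> TX; rewrite -[X]add0r projectionE //; exact: in_dist0 (hP X).1.
Qed.

Lemma projection0 : P 0 = 0.
Proof. exact: projection_eq0 (in_dist0 linT (hP 0).2). Qed.

Lemma projectionD X Y : P (X + Y) = P X + P Y.
Proof. by rewrite -[X in LHS]scale1r projectionP scale1r. Qed.

Lemma projectionZ f X : P (f *: X) = f *: P X.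
Proof. by rewrite -[f *: X]addr0 projectionP projection0 addr0. Qed.

Lemma projectionB X Y : P (X - Y) = P X - P Y.
Proof. by rewrite addrC -scaleN1r projectionP scaleN1r addrC. Qed.

Lemma parallel_endoE D :
  parallel_endo D P <-> forall X Y, D X (P Y) = P (D X Y).
Proof.
by split=> DP X Y; [exact/subr0_eq/DP|rewrite /endo_deriv DP subrr].
Qed.

(** [T] is the kernel of [P] and [S] its image, so a connection commuting with [P] preserves both.
    Conversely, apply [D X] to [Y = P Y + (Y - P Y)]: each term stays in its summand. *)
Lemma parallel_endo_projection D : connection D ->
  parallel_endo D P <-> parallel_dist D T /\ parallel_dist D S.
Proof.
move=> cD; split=> [/parallel_endoE DP|[DT DS]].
  split=> X Y EY.
    have [_] := hP (D X Y).
    by rewrite -DP (projection_eq0 EY) (connection0 _ cD) subr0.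
  by have [] := hP (D X Y); rewrite -DP (projection_id EY).
apply/parallel_endoE => X Y; have [SY TY] := hP Y; have [_ DD _] := cD.
rewrite -[in RHS](subrK (P Y) Y) [_ - _ + _]addrC DD projectionE //.
  exact: DS.
exact: DT.
Qed.

(** [D] and [D'] are the mean plus and minus the difference tensor, and [P] is linear over the
    smooth functions. *)
Lemma parallel_endo_mean D D' :
  parallel_endo D P /\ parallel_endo D' P <->
  parallel_endo (mean_connection D D') P /\
  (forall X Y, difference_tensor D D' X (P Y) = P (difference_tensor D D' X Y)).
Proof.
have DE X Y : D X Y = mean_connection D D' X Y + difference_tensor D D' X Y.
  rewrite /mean_connection /difference_tensor -scalerDr addrACA subrr addr0.
  by rewrite half_double.
have D'E X Y : D' X Y = mean_connection D D' X Y - difference_tensor D D' X Y.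
  rewrite /mean_connection /difference_tensor -scalerBr opprB addrC addrA subrK.
  by rewrite half_double.
split=> [[/parallel_endoE DP /parallel_endoE D'P]|[/parallel_endoE mP dP]].
  split; first apply/parallel_endoE; move=> X Y.
    by rewrite /mean_connection projectionZ projectionD DP D'P.
  by rewrite /difference_tensor projectionZ projectionB DP D'P.
split; apply/parallel_endoE => X Y.
  by rewrite !DE projectionD mP dP.
by rewrite !D'E projectionB mP dP.
Qed.

End Projection.
End VectorFields.

(** * Induced connections, and parallelism of the radical and of the screen *)

Section LightlikeHypersurface.
Context {R : realType} {n : nat} {M : manifold R n} {Mbar : manifold R n.+1}.
Variables (g : metric Mbar) (F : smooth_map M Mbar).
Variables (xi : vfield M) (S : M -> set (Cinf M -> R)).
Hypotheses (hxi : radical_frame g F xi) (hS : screen_distribution g F S).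

Lemma radicalE p v : radical g F p v <-> exists a : R, v = a *: xi p.
Proof. by have [_ ->] := hxi p. Qed.

Lemma radical_linear : linear_dist (radical g F).
Proof.
move=> p a u v /radicalE[b ->] /radicalE[c ->]; apply/radicalE.
by exists (a * b + c); rewrite scalerDl scalerA.
Qed.

Lemma screen_linear : linear_dist S.
Proof. by have [/distribution_linear] := hS. Qed.

Lemma in_radicalZ (f : Cinf M) : in_dist (radical g F) (f *: xi).
Proof. by move=> p; apply/radicalE; exists (f p). Qed.

Lemma pushforwardP (f : Cinf M) (X Y : vfield M) :
  pushforward F (f *: X + Y) = f *: pushforward F X + pushforward F Y.
Proof. exact: vsection_eq. Qed.

Lemma pushforwardD (X Y : vfield M) :
  pushforward F (X + Y) = pushforward F X + pushforward F Y.
Proof. exact: vsection_eq. Qed.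

Lemma pushforwardZ (f : Cinf M) (X : vfield M) :
  pushforward F (f *: X) = f *: pushforward F X.
Proof. exact: vsection_eq. Qed.

Lemma pushforwardB (X Y : vfield M) :
  pushforward F (X - Y) = pushforward F X - pushforward F Y.
Proof. exact: vsection_eq. Qed.

Lemma metric_0l p w : tangent p w -> g p 0 w = 0.
Proof.
(* With coefficient -1 the two terms on the right cancel. *)
move=> tw; have := metric_linear g (-1) (tangent0 p) (tangent0 p) tw.
by rewrite scaler0 addr0 mulN1r addNr.
Qed.

(** Pairing with [xi], which is orthogonal to tangent vectors and has product 1 with [N], gives
    [b = 0]; then the immersion property gives [W = 0]. *)
Lemma pushforward_transversal_eq0 (N : vsection F) (W : vfield M) (b : Cinf M) :
  lightlike_hypersurface g F -> lightlike_transversal g S xi N ->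
  pushforward F W + b *: N = 0 -> W = 0.
Proof.
move=> [_ immF _] hN WN; apply: vsection_eq => p.
have tW := vsection_tangent W p; have tN := vsection_tangent N p.
have tFW := tangent_dmap F tW.
have [txi [tFxi Nxi]] : radical g F p (xi p).
  by apply/radicalE; exists 1; rewrite scale1r.
have WNp : b p *: N p + dmap F (W p) = 0.
  by rewrite addrC; exact: (vsection_at p WN).
have b0 : b p = 0.
  have := metric_linear g (b p) tN tFW tFxi.
  rewrite WNp (metric_0l tFxi) (metric_sym g tFW tFxi) Nxi // addr0.
  by have [_ -> _] := hN p; rewrite mulr1.
apply: (immF p) => //; first exact: tangent0.
by move: WNp; rewrite b0 scale0r add0r.
Qed.

Lemma gauss_connection (N : vsection F) DF D B :
  lightlike_hypersurface g F -> lightlike_transversal g S xi N ->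
  connection DF -> gauss_formula N DF D B -> connection D.
Proof.
move=> hM hN [DFl DFD DFZ] hD.
(* Each axiom for [D] is the tangential part of the same axiom for [DF]; the transversal
   coefficients of both sides are supplied by hand. *)
have tangential (W W' : vfield M) (b b' : Cinf M) :
    pushforward F W + b *: N = pushforward F W' + b' *: N -> W = W'.
  move=> e; apply/subr0_eq/(pushforward_transversal_eq0 (b := b - b') hM hN).
  by rewrite pushforwardB scalerBl addrACA -opprD e subrr.
split=> [f X X' V|X V V'|f X V].
- apply: (tangential _ _ (B (f *: X + X') V) (f * B X V + B X' V)).
  by rewrite -hD DFl !hD pushforwardP scalerDl scalerDr scalerA addrACA.
- apply: (tangential _ _ (B X (V + V')) (B X V + B X V')).
  by rewrite -hD !pushforwardD DFD !hD scalerDl addrACA.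
- apply: (tangential _ _ (B X (f *: V)) (f * B X V)).
  by rewrite -hD pushforwardZ DFZ hD pushforwardP pushforwardZ scalerDr
    scalerA addrA.
Qed.

(** Up to sign, [A X] is the screen component of [D X xi]. For the converse, the formula for
    [D X xi] is carried over to every section of the radical. *)
Lemma parallel_radicalP D A tau :
  connection D -> radical_weingarten S xi D A tau ->
  parallel_dist D (radical g F) <-> forall X, A X = 0.
Proof.
have [_ SR _] := hS.
move=> [_ _ DZ] hA; split=> [DR X|A0 X V RV p].
  have [SA e] := hA X; apply: (in_distI0 SR) => //.
  have -> : A X = (- tau X) *: xi - D X xi.
    by rewrite e scaleNr opprB opprK addKr.
  apply: in_distB; [exact: radical_linear|exact: in_radicalZ|].
  by apply: DR; rewrite -[xi]scale1r; exact: in_radicalZ.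
have [xi0 _] := hxi p.
have [h xih] : exists h, xi p h != 0.
  apply: contrapT => nh; apply: xi0; apply/funext => h.
  by apply/eqP; apply: contrapT => /negP xih; apply: nh; exists h.
(* If [V q = a *: xi q], both sides at [q] are [(a * xi q h) *: xi q]. This avoids proving that [a]
   depends smoothly on [q]. *)
have e : vderiv xi h *: V = vderiv V h *: xi.
  apply: vsection_eq => q; have /radicalE[a Vq] := RV q.
  change (xi q h *: V q = V q h *: xi q).
  by rewrite Vq scalerA mulrC.
(* Apply [D X] to [e] and use the Leibniz rule on both sides, with [D X xi = - tau X *: xi].
   Division by [xi p h] is then done at [p] only, since [vderiv xi h] may vanish elsewhere. *)
have Rxi : in_dist (radical g F) (vderiv xi h *: D X V).
  have -> : vderiv xi h *: D X V =
      (vderiv X (vderiv V h) - vderiv V h * tau X) *: xi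
      - vderiv X (vderiv xi h) *: V.
    apply/(addrI (vderiv X (vderiv xi h) *: V)); rewrite -DZ e DZ.
    rewrite (hA X).2 A0 oppr0 sub0r scalerN scalerA -scalerBl.
    by rewrite [RHS]addrC subrK.
  apply: in_distB; [exact: radical_linear|exact: in_radicalZ|].
  exact: in_distZ radical_linear RV.
have /radicalE[a ea] := Rxi p.
apply/radicalE; exists ((xi p h)^-1 * a); rewrite -scalerA -ea.
change (D X V p = (xi p h)^-1 *: (xi p h *: D X V p)).
by rewrite scalerA mulVf // scale1r.
Qed.

(** [C X W *: xi] is the radical component of [D X W], so it vanishes exactly when [D X W] is a
    screen field. *)
Lemma parallel_screenP D DS C : screen_gauss S xi D DS C ->
  parallel_dist D S <-> forall X W, in_dist S W -> C X W = 0.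
Proof.
have [_ SR _] := hS.
move=> hC; split=> [DS_ X W SW|C0 X W SW]; have [SD e] := hC X W SW; last first.
  by rewrite e C0 // scale0r addr0.
have Cxi0 : C X W *: xi = 0.
  apply: (in_distI0 SR); last exact: in_radicalZ.
  have -> : C X W *: xi = D X W - DS X W by rewrite e addrC addKr.
  by apply: in_distB => //; [exact: screen_linear|exact: DS_].
(* Cancelling [xi] is done pointwise, where the scalars form a field and [xi p] is nonzero. *)
apply: Cinf_eq => p; have [xi0 _] := hxi p.
have /eqP : C X W p *: xi p = 0 by exact: (vsection_at p Cxi0).
by rewrite scaler_eq0 => /orP[/eqP //|/eqP].
Qed.

End LightlikeHypersurface.

(** * Equivalence of the four conditions on the induced connections *)

Theorem theorem3p4 (R : realType) (n : nat)
    (* the indefinite statistical manifold *)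
    (Mbar : manifold R n.+1) (gbar : metric Mbar)
    (Dbar Dbar' : vfield Mbar -> vfield Mbar -> vfield Mbar)
    (hbar : statistical_manifold gbar Dbar Dbar')
    (* the lightlike hypersurface *)
    (M : manifold R n) (F : smooth_map M Mbar)
    (hM : lightlike_hypersurface gbar F)
    (xi : vfield M) (hxi : radical_frame gbar F xi)
    (S : M -> set (Cinf M -> R)) (hS : screen_distribution gbar F S)
    (N : vsection F) (hN : lightlike_transversal gbar S xi N)
    (* Dbar_X V and Dbar'_X V for vector fields V along M *)
    (DF DF' : vfield M -> vsection F -> vsection F)
    (hDF : pullback_connection Dbar DF) (hDF' : pullback_connection Dbar' DF')
    (* the induced objects *)
    (D D' : vfield M -> vfield M -> vfield M)
    (B B' : vfield M -> vfield M -> Cinf M)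
    (hD : gauss_formula N DF D B) (hD' : gauss_formula N DF' D' B')
    (A A' : vfield M -> vfield M) (tau tau' : vfield M -> Cinf M)
    (hA : radical_weingarten S xi D A tau)
    (hA' : radical_weingarten S xi D' A' tau')
    (DS DS' : vfield M -> vfield M -> vfield M)
    (C C' : vfield M -> vfield M -> Cinf M)
    (hC : screen_gauss S xi D DS C) (hC' : screen_gauss S xi D' DS' C')
    (P : vfield M -> vfield M)
    (hP : projection_along S (radical gbar F) P) :
  [<-> (parallel_dist D (radical gbar F) /\ parallel_dist D S) /\
       (parallel_dist D' (radical gbar F) /\ parallel_dist D' S);
       parallel_endo D P /\ parallel_endo D' P;
       (forall X, A X = 0) /\ (forall X, A' X = 0) /\
       (forall X W, in_dist S W -> C X W = 0 /\ C' X W = 0);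
       parallel_endo (mean_connection D D') P /\
       (forall X Y, difference_tensor D D' X (P Y) =
                    P (difference_tensor D D' X Y))].
Proof.
have [_ SR _] := hS.
have linS := screen_linear hS; have linR := radical_linear hxi.
have cD : connection D := gauss_connection hxi hM hN hDF.1 hD.
have cD' : connection D' := gauss_connection hxi hM hN hDF'.1 hD'.
have endoP := parallel_endo_projection linS linR SR hP.
have PR := parallel_radicalP hxi hS cD hA.
have PR' := parallel_radicalP hxi hS cD' hA'.
have PS := parallel_screenP hxi hS hC; have PS' := parallel_screenP hxi hS hC'.
have one_two : parallel_endo D P /\ parallel_endo D' P <->
    (parallel_dist D (radical gbar F) /\ parallel_dist D S) /\
    (parallel_dist D' (radical gbar F) /\ parallel_dist D' S).
  by rewrite (endoP D cD) (endoP D' cD').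
have two_four := parallel_endo_mean linS linR SR hP D D'.
(* The cycle (1), (2), (3), (4), (1): the links through (3) pass by (1), where [PR], [PS] and their
   duals translate parallelism into vanishing. *)
tfae.
- by move/one_two.
- move/one_two => [[/PR A0 /PS C0] [/PR' A'0 /PS' C'0]].
  by split=> //; split=> // X W SW; split; [exact: C0|exact: C'0].
- move=> [A0 [A'0 C0]]; apply/two_four/one_two.
  split; (split; [exact/PR || exact/PR'|]).
    by apply/PS => X W /(C0 X)[].
  by apply/PS' => X W /(C0 X)[].
- by move/two_four/one_two.
Qed.
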